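(* Let $d\ge2$, $\boldsymbol c=(c_1,\dots,c_d)\in\mathbb{R}^d$, and let $x_1,\dots,x_d$ be independent real random variables such that each $x_j$ has a bounded probability density function $h_j$ on $\mathbb{R}$, and such that each $c_j$ belongs to an interval $I_j$ of positive length on which $h_j$ is bounded below by a positive constant. For $\vartheta>0$ define the Gaussian radial basis function $$f_\vartheta(\boldsymbol x)=\prod_{j=1}^d\exp\bigl(-(x_j-c_j)^2/\vartheta^2\bigr).$$ Then for every real number $m\in(1,d)$ there exists $\vartheta>0$ such that the mean dimension of $f_\vartheta$ satisfies $\nu(f_\vartheta)=m$.
   Context: Mean dimension: let $f$ be a function of $d$ independent random variables $\boldsymbol x=(x_1,\dots,x_d)$ with $0<\mathrm{Var}(f(\boldsymbol x))<\infty$. Its ANOVA decomposition is $f=\sum_{u\subseteq\{1,\dots,d\}}f_u$, where $f_u(\boldsymbol x)=\mathbb{E}(f(\boldsymbol x)\mid x_j, j\in u)-\sum_{v\subsetneq u}f_v(\boldsymbol x)$; the $f_u$ are mutually orthogonal. With $\sigma_u^2=\mathrm{Var}(f_u(\boldsymbol x))$ and $\sigma^2=\mathrm{Var}(f(\boldsymbol x))=\sum_u\sigma_u^2$, the mean dimension is $\nu(f)=\frac1{\sigma^2}\sum_{u}|u|\,\sigma_u^2$. *)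

(* Defs.v *)
From HB Require Import structures.
From mathcomp Require Import all_boot all_order all_algebra.
From mathcomp Require Import all_classical all_reals all_analysis.

Set Implicit Arguments.
Unset Strict Implicit.
Unset Printing Implicit Defensive.

Import Order.TTheory GRing.Theory Num.Theory.
Import numFieldNormedType.Exports.

Local Open Scope classical_set_scope.
Local Open Scope ring_scope.

Definition gaussian_rbf (R : realType) (d : nat) (c : 'rV[R]_d) (theta : R)
    (x : 'rV[R]_d) : R :=
  \prod_(j < d) expR (- (x 0 j - c 0 j) ^+ 2 / theta ^+ 2).

Section RandomVariables.
Context (disp : measure_display) (T : measurableType disp) (R : realType).
Variable P : probability T R.

Definition has_density (X : {RV P >-> R}) (h : R -> R) : Prop :=
  [/\ measurable_fun setT h, (forall x, 0 <= h x) &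
      forall B : set R, measurable B ->
        distribution P X B = (\int[lebesgue_measure]_(x in B) (h x)%:E)%E].

Definition mutually_independent (I : finType) (X : I -> {RV P >-> R}) : Prop :=
  forall (J : {set I}) (B : I -> set R),
    (forall j, measurable (B j)) ->
    P (\bigcap_(j in [set` J]) (X j @^-1` B j)) =
    (\prod_(j in J) P (X j @^-1` B j))%E.

(* Y' is a version of the conditional expectation of Y given the sub-sigma-
   algebra G; the first clause is G-measurability. *)
Definition is_cond_expectation (G : set (set T)) (Y Y' : T -> R) : Prop :=
  [/\ (forall B : set R, measurable B -> G (Y' @^-1` B)),
      P.-integrable setT (EFin \o Y') &
      forall A, G A ->
        (\int[P]_(w in A) (Y' w)%:E = \int[P]_(w in A) (Y w)%:E)%E].

(* For integrable Y a version exists and any two agree almost surely, so the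
   choice made here does not affect variances; the default value 0 is only
   reached when there is no version. *)
Definition cond_expectation (G : set (set T)) (Y : T -> R) : T -> R :=
  xget (cst 0) [set Y' | is_cond_expectation G Y Y'].

Definition sigma_of (I : finType) (X : I -> {RV P >-> R}) (u : {set I}) :
    set (set T) :=
  <<s \bigcup_(j in [set` u]) preimage_set_system setT (X j) measurable >>.

(* The ANOVA component for u is cond_expectation (sigma_of X u) Y minus the sum
   of the components for the proper subsets of u. The recursion is bounded by
   n; the value no longer depends on n once #|u| < n, and anovaE below is the
   recursion itself. *)
Fixpoint anova_rec (I : finType) (X : I -> {RV P >-> R}) (Y : T -> R)
    (n : nat) (u : {set I}) : T -> R :=
  if n is n'.+1 then
    fun w => cond_expectation (sigma_of X u) Y w
             - \sum_(v : {set I} | v \proper u) anova_rec X Y n' v w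
  else cst 0.

Definition anova (I : finType) (X : I -> {RV P >-> R}) (Y : T -> R)
    (u : {set I}) : T -> R :=
  anova_rec X Y #|u|.+1 u.

Lemma anovaE (I : finType) (X : I -> {RV P >-> R}) (Y : T -> R)
    (u : {set I}) (w : T) :
  anova X Y u w = cond_expectation (sigma_of X u) Y w
                  - \sum_(v : {set I} | v \proper u) anova X Y v w.
Proof.
have stable n m (v : {set I}) : (#|v| < n)%N -> (#|v| < m)%N ->
    anova_rec X Y n v w = anova_rec X Y m v w.
  elim: n m v => // n IHn [//|m] v vn vm /=.
  congr (_ - _); apply: eq_bigr => v' /proper_card v'v.
  by apply: IHn; exact: leq_trans v'v _.
rewrite {1}/anova /=; congr (_ - _); apply: eq_bigr => v /proper_card vu.
exact: stable.
Qed.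

(* Only the variance of the function itself, which divides, is turned into a
   real number; if it were 0 or infinite the result would be 0. *)
Definition mean_dimension (d : nat) (X : 'I_d -> {RV P >-> R})
    (f : 'rV[R]_d -> R) : \bar R :=
  let Y := fun w => f (\row_j X j w) in
  (((fine 'V_P[Y])^-1)%:E
   * \sum_(u : {set 'I_d}) (#|u|%:R)%:E * 'V_P[anova X Y u])%E.

End RandomVariables.

(* Main.v *)
Require Import Defs.
From HB Require Import structures.
From mathcomp Require Import all_boot all_order all_algebra.
From mathcomp Require Import all_classical all_reals all_analysis.
From mathcomp Require Import measurable_realfun ring lra.

(** For independent [X_j], bounded factors [g_j], and with [mu_j], [s_j] the means of
    [g_j(X_j)] and [g_j(X_j)^2], the ANOVA component of [prod_j g_j(X_j)] for [u] is almost
    surely [prod_(j in u) (g_j(X_j) - mu_j) * prod_(j notin u) mu_j]. Hence the mean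
    dimension is [sum_j (1 - r_j) / (1 - prod_j r_j)], where [r_j = mu_j^2 / s_j].
    For the Gaussian factors write [t = theta^-2]. Then [r_j] is continuous in [t], equals 1
    at [t = 0], lies strictly between 0 and 1 for [t > 0] (as [X_j] has a density), and tends
    to 0 as [t] grows: the upper bound on the density gives [mu_j = O(theta)], and the lower
    bound near [c_j] shows that [s_j] is at least a multiple of [theta]. Since
    [(sum_j (1 - r_j)) * prod_j r_j <= 1 - prod_j r_j], the mean dimension tends to 1 as [t]
    tends to 0, and to [d] as [t] tends to infinity; conclude by the intermediate value
    theorem, applied to [sum_j (1 - r_j) - m * (1 - prod_j r_j)] to avoid the quotient. *)

Set Implicit Arguments.
Unset Strict Implicit.
Unset Printing Implicit Defensive.

Import Order.TTheory GRing.Theory Num.Theory.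
Import numFieldNormedType.Exports.

Local Open Scope classical_set_scope.
Local Open Scope ring_scope.

(** * Bounded measurable functions and their integrals *)

Section BoundedMeasurable.
Context (disp : measure_display) (T : measurableType disp) (R : realType).
Implicit Types f g : T -> R.

(** The class is stable under sums and products and integrable for every probability, so the
    integrals below are finite reals and linearity needs no further side conditions. *)
Definition bounded_measurable f : Prop :=
  measurable_fun setT f /\ exists M : R, forall x, `|f x| <= M.

Lemma bounded_measurable_cst (a : R) : bounded_measurable (fun=> a).
Proof. by split => //; exists `|a|. Qed.

Lemma bounded_measurable_indic (A : set T) :
  measurable A -> bounded_measurable (\1_A).
Proof.
move=> mA; split; first exact: measurable_indic.
by exists 1 => x; rewrite indicE ger0_norm ?ler0n// lern1; case: (_ \in _).
Qed.

Lemma bounded_measurableD f g : bounded_measurable f -> bounded_measurable g ->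
  bounded_measurable (fun x => f x + g x).
Proof.
move=> [mf [M fM]] [mg [N gN]]; split; first exact: measurable_funD.
by exists (M + N) => x; rewrite (le_trans (ler_normD _ _)) ?lerD.
Qed.

Lemma bounded_measurableM f g : bounded_measurable f -> bounded_measurable g ->
  bounded_measurable (fun x => f x * g x).
Proof.
move=> [mf [M fM]] [mg [N gN]]; split; first exact: measurable_funM.
by exists (M * N) => x; rewrite normrM ler_pM.
Qed.

Lemma bounded_measurableN f : bounded_measurable f ->
  bounded_measurable (fun x => - f x).
Proof.
move=> [mf [M fM]]; split; first exact: measurableT_comp.
by exists M => x; rewrite normrN.
Qed.

Lemma bounded_measurableB f g : bounded_measurable f -> bounded_measurable g ->
  bounded_measurable (fun x => f x - g x).
Proof.
by move=> bf bg; apply: bounded_measurableD => //; exact: bounded_measurableN.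
Qed.

Lemma bounded_measurable_prod (I : Type) (s : seq I) (p : pred I)
    (f : I -> T -> R) : (forall i, bounded_measurable (f i)) ->
  bounded_measurable (fun x => \prod_(i <- s | p i) f i x).
Proof.
move=> bf; elim: s => [|i s IHs].
  under eq_fun do rewrite big_nil; exact: bounded_measurable_cst.
under eq_fun do rewrite big_cons.
by case: (p i) => //; exact: bounded_measurableM.
Qed.

Lemma bounded_measurable_sum (I : Type) (s : seq I) (p : pred I)
    (f : I -> T -> R) : (forall i, bounded_measurable (f i)) ->
  bounded_measurable (fun x => \sum_(i <- s | p i) f i x).
Proof.
move=> bf; elim: s => [|i s IHs].
  under eq_fun do rewrite big_nil; exact: bounded_measurable_cst.
under eq_fun do rewrite big_cons.
by case: (p i) => //; exact: bounded_measurableD.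
Qed.

Variable P : probability T R.

Lemma bounded_measurable_integrable f (D : set T) : measurable D ->
  bounded_measurable f -> P.-integrable D (EFin \o f).
Proof.
move=> mD [mf [M fM]]; apply: measurable_bounded_integrable => //.
- by rewrite (le_lt_trans (probability_le1 _ mD)) ?ltry.
- exact: measurable_funTS.
- exists M; split; first exact: num_real.
  by move=> K MK x _; exact: le_trans (fM x) (ltW MK).
Qed.

Lemma EFin_Rintegral f (D : set T) : measurable D -> bounded_measurable f ->
  (\int[P]_(x in D) (f x)%:E)%E = (\int[P]_(x in D) f x)%:E.
Proof.
move=> mD bf; rewrite /Rintegral fineK//.
exact: (integrable_fin_num _ (bounded_measurable_integrable mD bf)).
Qed.

Lemma bounded_RintegralD f g : bounded_measurable f -> bounded_measurable g ->
  \int[P]_x (f x + g x) = \int[P]_x f x + \int[P]_x g x.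
Proof.
by move=> bf bg; rewrite RintegralD//; exact: bounded_measurable_integrable.
Qed.

Lemma bounded_RintegralB f g : bounded_measurable f -> bounded_measurable g ->
  \int[P]_x (f x - g x) = \int[P]_x f x - \int[P]_x g x.
Proof.
by move=> bf bg; rewrite RintegralB//; exact: bounded_measurable_integrable.
Qed.

Lemma bounded_RintegralZl f a : bounded_measurable f ->
  \int[P]_x (a * f x) = a * \int[P]_x f x.
Proof.
by move=> bf; rewrite RintegralZl//; exact: bounded_measurable_integrable.
Qed.

Lemma probability_Rintegral_cst (a : R) : \int[P]_x a = a.
Proof. by rewrite Rintegral_cst// [X in fine X]probability_setT mulr1. Qed.

Lemma Rintegral_indic (A : set T) : measurable A ->
  \int[P]_x \1_A x = fine (P A).
Proof. by move=> mA; rewrite /Rintegral integral_indic// setIT. Qed.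

Lemma bounded_Rintegral_sum (I : Type) (s : seq I) (p : pred I)
    (f : I -> T -> R) : (forall i, bounded_measurable (f i)) ->
  \int[P]_x (\sum_(i <- s | p i) f i x) = \sum_(i <- s | p i) \int[P]_x f i x.
Proof.
move=> bf; elim: s => [|i s IHs].
  under eq_Rintegral do rewrite big_nil.
  by rewrite probability_Rintegral_cst big_nil.
under eq_Rintegral do rewrite big_cons.
rewrite big_cons; case: ifP => // _.
by rewrite bounded_RintegralD ?IHs//; exact: bounded_measurable_sum.
Qed.

Lemma Rintegral_norm_le f (M : R) : bounded_measurable f ->
  (forall x, `|f x| <= M) -> `|\int[P]_x f x| <= M.
Proof.
move=> bf fM; rewrite -[leRHS]probability_Rintegral_cst.
have bnf : bounded_measurable (fun x => `|f x|).
  by split; [apply: measurableT_comp => //; case: bf|exists M => x; rewrite normr_id].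
apply: le_trans (le_normr_Rintegral _ _) _ => //.
  exact: bounded_measurable_integrable.
apply: le_Rintegral => //.
  exact: (@bounded_measurable_integrable (fun x => `|f x|)).
exact: (bounded_measurable_integrable _ (bounded_measurable_cst M)).
Qed.

End BoundedMeasurable.

Lemma bounded_measurable_comp (d1 d2 : measure_display)
    (T1 : measurableType d1) (T2 : measurableType d2) (R : realType)
    (X : T1 -> T2) (phi : T2 -> R) :
  measurable_fun setT X -> bounded_measurable phi ->
  bounded_measurable (fun w => phi (X w)).
Proof.
move=> mX [mphi [M phiM]]; split; first exact: measurableT_comp.
by exists M.
Qed.

Lemma sum_ltn_ord (n N : nat) : (n <= N)%N ->
  (\sum_(k < N) (k < n)%N)%N = n.
Proof.
move=> nN; transitivity (\sum_(k < N | (k < n)%N) 1)%N.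
  by rewrite [RHS]big_mkcond; apply: eq_bigr => k _; case: ltnP.
by rewrite (big_ord_narrow nN) sum_nat_const card_ord muln1.
Qed.

(** * Independence *)

(** Layer-cake rounding: [phi + M] is rounded down to a multiple of [e], and that multiple counts
    the levels [e], [2e], ... that [phi + M] reaches. *)
Lemma uniform_approx_indic (disp : measure_display) (T : measurableType disp)
    (R : realType) (phi : T -> R) (M e : R) :
  measurable_fun setT phi -> (forall x, `|phi x| <= M) -> 0 < e ->
  exists N (B : nat -> set T), (forall k, measurable (B k)) /\
    forall x, `|phi x - (e * (\sum_(k < N) \1_(B k) x) - M)| <= e.
Proof.
move=> mphi phiM e0.
(* Since [phi + M <= 2M], at most [(M + M) / e] levels are reached. The index [k] stands for level
   [k.+1], as level 0 is always reached. *)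
pose N := (Num.truncn ((M + M) / e)).+1.
exists N, (fun k => phi @^-1` `[e * k.+1%:R - M, +oo[); split.
  by move=> k; rewrite -[X in measurable X]setTI; apply: mphi.
move=> x; set t := (phi x + M) / e.
have /andP[phiMl phiMu] : - M <= phi x <= M by rewrite -ler_norml.
have t0 : 0 <= t by apply: divr_ge0; [lra|exact: ltW].
have -> : \sum_(k < N) \1_(phi @^-1` `[e * k.+1%:R - M, +oo[) x =
    (Num.truncn t)%:R :> R.
  have tN : (Num.truncn t <= N)%N.
    by apply: leqW; apply: le_truncn; rewrite ler_pM2r ?invr_gt0//; lra.
  rewrite -(sum_ltn_ord tN) natr_sum.
  apply: eq_bigr => k _; rewrite indicE; congr (nat_of_bool _)%:R.
  rewrite truncn_ge_nat// ler_pdivlMr// mulrC.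
  apply/idP/idP; rewrite inE/= in_itv/= andbT; lra.
have /andP[tl tu] := truncn_itv t0.
have phiE : phi x = e * t - M by rewrite /t mulrCA divff ?gt_eqF// mulr1 addrK.
rewrite {1}phiE opprB addrA subrK -mulrBr normrM gtr0_norm//.
rewrite ger_pMr// ger0_norm ?subr_ge0//.
by rewrite lerBlDr addrC -natr1 in tu *; exact: ltW.
Qed.

Section Independence.
Context (disp : measure_display) (T : measurableType disp) (R : realType).
Variable P : probability T R.

(** The integral is linear in [phi] and, [V] being bounded, continuous for uniform convergence, so
    it is enough that it vanishes on indicators. *)
Lemma Rintegral_comp_eq0 (X V : T -> R) (phi : R -> R) :
  measurable_fun setT X -> bounded_measurable V -> bounded_measurable phi ->
  (forall B, measurable B -> \int[P]_w (\1_B (X w) * V w) = 0) ->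
  \int[P]_w (phi (X w) * V w) = 0.
Proof.
move=> mX bV bphi HB; have [mphi [M phiM]] := bphi; have [_ [K VK]] := bV.
have K0 : 0 <= K := le_trans (normr_ge0 _) (VK point).
apply/eqP; rewrite -normr_le0; apply/ler_addgt0Pr => e e0; rewrite add0r.
(* [K] bounds the absolute value of [V] and may be 0, hence the 1. An error [e / (K + 1)] in [phi]
   costs at most [e] in the integral. *)
have e'0 : 0 < e / (K + 1) by rewrite divr_gt0 ?ltr_wpDl.
have [N [B [mB phiB]]] := uniform_approx_indic mphi phiM e'0.
set a := e / (K + 1) in phiB e'0.
pose psi x := a * (\sum_(k < N) \1_(B k) x) - M.
have bpsi : bounded_measurable psi.
  apply: bounded_measurableB; last exact: bounded_measurable_cst.
  apply: bounded_measurableM; first exact: bounded_measurable_cst.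
  by apply: bounded_measurable_sum => k; exact: bounded_measurable_indic.
have bX (f : R -> R) : bounded_measurable f ->
    bounded_measurable (fun w => f (X w) * V w).
  by move=> bf; apply: bounded_measurableM => //; exact: bounded_measurable_comp.
have bind k : bounded_measurable (fun w => \1_(B k) (X w) * V w).
  exact/bX/bounded_measurable_indic.
have psi0 : \int[P]_w (psi (X w) * V w) = 0.
  (* The constant [M] is written as a multiple of [\1_setT], so that [HB] covers it too. *)
  transitivity (\int[P]_w (a * (\sum_(k < N) \1_(B k) (X w) * V w)
                           - M * (\1_setT (X w) * V w))).
    by apply: eq_Rintegral => w _; rewrite /psi indicT mulrBl -mulrA mulr_suml mul1r.
  have bT : bounded_measurable (fun w => \1_setT (X w) * V w).
    by apply: (bX (\1_setT)); exact: bounded_measurable_indic.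
  have bsum : bounded_measurable (fun w => \sum_(k < N) \1_(B k) (X w) * V w).
    exact: bounded_measurable_sum.
  rewrite bounded_RintegralB ?bounded_RintegralZl//;
    try by apply: bounded_measurableM => //; exact: bounded_measurable_cst.
  rewrite HB// mulr0 subr0 bounded_Rintegral_sum// big1 ?mulr0// => k _.
  exact: HB.
rewrite -[X in `|X|]subr0 -[X in _ - X]psi0 -bounded_RintegralB; [|exact: bX..].
apply: (@le_trans _ _ (a * K)).
  apply: Rintegral_norm_le => [|w].
    by apply: bounded_measurableB; exact: bX.
  by rewrite -mulrBl normrM ler_pM.
by rewrite /a mulrAC ler_pdivrMr ?ltr_wpDl// ler_pM2l// lerDl.
Qed.

(** The product rule for [f (X)] and [W] says that [f (X)] integrates to 0 against [W] minus its
    mean, so [Rintegral_comp_eq0] applies. *)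
Lemma Rintegral_indep_comp (X W : T -> R) (phi : R -> R) :
  measurable_fun setT X -> bounded_measurable W -> bounded_measurable phi ->
  (forall B, measurable B -> \int[P]_w (\1_B (X w) * W w) =
    (\int[P]_w \1_B (X w)) * \int[P]_w W w) ->
  \int[P]_w (phi (X w) * W w) = (\int[P]_w phi (X w)) * \int[P]_w W w.
Proof.
move=> mX bW bphi HB; set m := \int[P]_w W w.
have split_int (f : R -> R) : bounded_measurable f ->
    \int[P]_w (f (X w) * (W w - m)) =
    \int[P]_w (f (X w) * W w) - (\int[P]_w f (X w)) * m.
  move=> bf; have bfX := bounded_measurable_comp mX bf.
  rewrite mulrC -bounded_RintegralZl// -bounded_RintegralB//; last 2 first.
  - exact: bounded_measurableM.
  - by apply: bounded_measurableM => //; exact: bounded_measurable_cst.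
  by apply: eq_Rintegral => w _; rewrite mulrBr [m * _]mulrC.
apply/eqP; rewrite -subr_eq0 -split_int//; apply/eqP.
apply: Rintegral_comp_eq0 => //.
  by apply: bounded_measurableB => //; exact: bounded_measurable_cst.
move=> B mB; rewrite split_int; last exact: bounded_measurable_indic.
by rewrite HB// subrr.
Qed.

(* Induction on the number of factors that are not indicator functions. *)
Lemma Rintegral_prod_indep (I : finType) (X : I -> {RV P >-> R})
    (phi : I -> R -> R) : mutually_independent X ->
  (forall i, bounded_measurable (phi i)) ->
  \int[P]_w (\prod_i phi i (X i w)) = \prod_i \int[P]_w phi i (X i w).
Proof.
move=> hX bphi.
have [n] : exists n,
    (#|finset (fun i => ~~ `[< exists2 B, measurable B & phi i = \1_B >])| <= n)%N.
  by exists #|I|; exact: max_card.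
elim: n phi bphi => [|n IHn] phi bphi.
  rewrite leqn0 cards_eq0 => /eqP /setP phi_ind.
  have {phi_ind}/choice[B HB] : forall i, exists B, measurable B /\ phi i = \1_B.
    move=> i; have /[!inE]/negbT := phi_ind i.
    by rewrite negbK => /asboolP[B mB ->]; exists B.
  have mB i : measurable (B i) by have [] := HB i.
  have phiE i x : phi i x = \1_(B i) x by have [_ ->] := HB i.
  have mXB i : measurable (X i @^-1` B i).
    by rewrite -[X in measurable X]setTI; exact: measurable_funPT.
  have -> : \prod_i \int[P]_w phi i (X i w) = fine (\prod_i P (X i @^-1` B i))%E.
    transitivity (\prod_i fine (P (X i @^-1` B i))); last first.
      rewrite -[LHS]/(fine _%:E) (big_morph EFin EFinM (erefl 1%:E)).
      by congr fine; apply: eq_bigr => i _; rewrite fineK// fin_num_measure.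
    apply: eq_bigr => i _; rewrite -Rintegral_indic//.
    by apply: eq_Rintegral => w _; rewrite phiE.
  have := hX [set: I]%SET B mB.
  under [in RHS]eq_bigl do rewrite inE.
  move=> <-; rewrite -Rintegral_indic; last first.
    by apply: fin_bigcap_measurable => //; exact: finite_finset.
  apply: eq_Rintegral => w _; rewrite indicE.
  case: (boolP (w \in _)) => [|/negP] /[!inE] Hw.
    rewrite big1// => i _; rewrite phiE indicE mem_set//.
    by apply: (Hw i); rewrite /= inE.
  apply/eqP; rewrite prodf_seq_eq0/=; apply/hasP.
  move: Hw => /existsNP[i /not_implyP[_ Hi]]; exists i; first exact: mem_index_enum.
  by rewrite phiE indicE memNset.
set S := finset _ => Sn.
have [/eqP S0|/set0Pn[k kS]] := boolP (S == finset.set0).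
  by apply: IHn => //; rewrite -/S S0 cards0.
(* [psi f] puts [f] in place of factor [k]; for an indicator [f] this lowers the count, so the
   induction hypothesis applies. *)
pose psi (f : R -> R) i := if i == k then f else phi i.
have bpsi f : bounded_measurable f -> forall i, bounded_measurable (psi f i).
  by move=> bf i; rewrite /psi; case: eqP.
have psiE f w : \prod_i psi f i (X i w) =
    f (X k w) * \prod_(i | i != k) phi i (X i w).
  rewrite (bigD1 k)//= /psi eqxx; congr (_ * _).
  by apply: eq_bigr => i /negbTE ->.
have IHpsi B : measurable B ->
    \int[P]_w (\1_B (X k w) * \prod_(i | i != k) phi i (X i w)) =
    (\int[P]_w \1_B (X k w)) * \prod_(i | i != k) \int[P]_w phi i (X i w).
  move=> mB; under eq_Rintegral do rewrite -psiE.
  rewrite IHn; last 2 first.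
  - exact/bpsi/bounded_measurable_indic.
  - rewrite -ltnS; apply: leq_trans Sn; apply: proper_card.
    apply/properP; split; last first.
      exists k => //; rewrite inE negbK; apply/asboolP; exists B => //.
      by rewrite /psi eqxx.
    apply/fintype.subsetP => i; rewrite !inE /psi; case: eqP => // _.
    by apply: contraNN => _; apply/asboolP; exists B.
  rewrite (bigD1 k)//= /psi eqxx; congr (_ * _).
  by apply: eq_bigr => i /negbTE ->.
have bW : bounded_measurable (fun w => \prod_(i | i != k) phi i (X i w)).
  apply: bounded_measurable_prod => i.
  exact: (bounded_measurable_comp (measurable_funPT (X i))).
(* Taking [B = setT] removes factor [k] and factors the integral of the remaining product. *)
have WE : \int[P]_w (\prod_(i | i != k) phi i (X i w)) =
    \prod_(i | i != k) \int[P]_w phi i (X i w).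
  transitivity (\int[P]_w (\1_setT (X k w) * \prod_(i | i != k) phi i (X i w))).
    by apply: eq_Rintegral => w _; rewrite indicT mul1r.
  rewrite IHpsi//; under eq_Rintegral do rewrite indicT.
  by rewrite probability_Rintegral_cst mul1r.
under eq_Rintegral do rewrite (bigD1 k)//=.
rewrite [RHS](bigD1 k)//= -WE; apply: Rintegral_indep_comp => //.
by move=> B mB; rewrite IHpsi// WE.
Qed.

End Independence.

(** * Conditional expectation and the ANOVA decomposition *)

Section CondExpectation.
Context (disp : measure_display) (T : measurableType disp) (R : realType).
Variable P : probability T R.

(** Dynkin's pi-lambda theorem: the measurable sets on which the two integrals agree form a
    lambda-system, by subtraction for complements and countable additivity for disjoint unions. *)
Lemma eq_integral_g_sigma_algebra (G : set (set T)) (f g : T -> \bar R) :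
  setI_closed G -> G `<=` measurable -> G setT ->
  P.-integrable setT f -> P.-integrable setT g ->
  (forall A, G A -> \int[P]_(x in A) f x = \int[P]_(x in A) g x)%E ->
  forall A, <<s G >> A -> (\int[P]_(x in A) f x = \int[P]_(x in A) g x)%E.
Proof.
move=> GI Gm GT fi gi fg A GA.
suff: (measurable `&` [set A | \int[P]_(x in A) f x = \int[P]_(x in A) g x]%E) A.
  by case.
apply: (lambda_system_subset GI _ _ _ GA) => //; last first.
  by move=> B GB; split; [exact: Gm|exact: fg].
apply/dynkin_lambda_system; split.
- by split; [exact: measurableT|exact: fg].
- have intC (h : T -> \bar R) B : measurable B -> P.-integrable setT h ->
      (\int[P]_(x in ~` B) h x = \int[P]_x h x - \int[P]_(x in B) h x)%E.
    move=> mB hi.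
    have hB : (\int[P]_(x in B) h x)%E \is a fin_num.
      exact: (integrable_fin_num mB (integrableS measurableT mB (@subsetT _ _) hi)).
    rewrite -(setvU B) integral_setU//; last 3 first.
    + exact: measurableC.
    + by apply: measurable_funS (measurable_int _ hi).
    + by apply/disj_setPS; rewrite setICl.
    by rewrite addeK.
  move=> B [mB fgB]; split; first exact: measurableC.
  by rewrite /= !intC// fgB fg.
- move=> F tF HF.
  have mF n : measurable (F n) by case: (HF n).
  split; first exact: bigcupT_measurable.
  have mU : measurable (\bigcup_n F n) by exact: bigcupT_measurable.
  rewrite /= !integral_bigcup//; try exact: (integrableS measurableT mU (@subsetT _ _) fi).
    by apply: eq_eseriesr => n _; case: (HF n).
  exact: (integrableS measurableT mU (@subsetT _ _) gi).
Qed.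

(** Both versions are measurable for [<<s G>>] and have equal integrals over all its sets, so they
    agree almost everywhere for the restriction of [P] to it. *)
Lemma is_cond_expectation_ae_eq (G : set (set T)) (Y Y1 Y2 : T -> R) :
  G `<=` measurable ->
  is_cond_expectation P <<s G >> Y Y1 -> is_cond_expectation P <<s G >> Y Y2 ->
  {ae P, forall w, Y1 w = Y2 w}.
Proof.
move=> Gm [mY1 iY1 eY1] [mY2 iY2 eY2].
have sGm : <<s G >> `<=` @measurable _ T.
  by apply: smallest_sub => //; exact: sigma_algebra_measurable.
(* [T'] is [T] with the sigma-algebra [<<s G>>]; the restriction of [P] to it is the pushforward [Q]
   along the identity. *)
pose T' := g_sigma_algebraType G.
have mid : measurable_fun setT (id : T -> T').
  by move=> _ B GB; rewrite setTI; exact: sGm.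
have mY (Y' : T -> R) : (forall B, measurable B -> <<s G >> (Y' @^-1` B)) ->
    measurable_fun setT (EFin \o Y' : T' -> \bar R).
  by move=> H; apply/measurable_EFinP => _ B mB; rewrite setTI; exact: H.
(* The measure instance takes the measurability proof as an argument, so it cannot be inferred. *)
pose Q : {measure set T' -> \bar R} :=
  measure_function_pushforward__canonical__measure_function_Measure P mid.
have intQ (Y' : T -> R) (B : set T') : (forall B, measurable B -> <<s G >> (Y' @^-1` B)) ->
    P.-integrable setT (EFin \o Y') -> measurable B ->
    (\int[Q]_(x in B) (Y' x)%:E = \int[P]_(x in B) (Y' x)%:E)%E.
  move=> H iY' mB; rewrite (integral_pushforward mid (mY _ H))//.
  exact: (integrableS measurableT (sGm _ mB) (@subsetT _ _) iY').
have : ae_eq Q setT (EFin \o Y1 : T' -> \bar R) (EFin \o Y2).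
  apply: integral_ae_eq => //.
  - by apply: (integrable_pushforward mid (mY _ mY1)).
  - exact: mY.
  - by move=> E _ mE; rewrite !intQ// eY1// eY2.
move=> [N [mN QN0 HN]]; exists N; split.
- exact: sGm.
- exact: QN0.
- apply: subset_trans HN => w /= H1 H2; apply: H1.
  by have := H2 I; case.
Qed.

End CondExpectation.

Section Anova.
Context (disp : measure_display) (T : measurableType disp) (R : realType).
Variables (P : probability T R) (I : finType) (X : I -> {RV P >-> R}).
Implicit Types (u v : {set I}) (g : I -> R -> R).

Lemma measurable_preimage_RV i (B : set R) :
  measurable B -> measurable (X i @^-1` B).
Proof. by move=> mB; rewrite -[X in measurable X]setTI; exact: measurable_funPT. Qed.

Let gen u : set (set T) :=
  \bigcup_(j in [set` u]) preimage_set_system setT (X j) measurable.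

Let gen_measurable u : gen u `<=` measurable.
Proof.
move=> A [j _ [B mB <-]]; rewrite setTI; exact: measurable_preimage_RV.
Qed.

(** A pi-system to which independence applies directly; the generators in [sigma_of] need not be
    closed under intersection. *)
Definition cylinder u : set (set T) :=
  [set A | exists B : I -> set R, (forall j, measurable (B j)) /\
     A = \bigcap_(j in [set` u]) (X j @^-1` B j)].

Lemma cylinder_setI_closed u : setI_closed (cylinder u).
Proof.
move=> _ _ [B [mB ->]] [C [mC ->]]; exists (fun j => B j `&` C j).
split; first by move=> j; exact: measurableI.
by rewrite -bigcapI.
Qed.

Lemma cylinder_setT u : cylinder u setT.
Proof.
by exists (fun=> setT); split => //; apply/seteqP; split => // w _ j _.
Qed.

Lemma cylinder_measurable u : cylinder u `<=` measurable.
Proof.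
move=> _ [B [mB ->]]; apply: fin_bigcap_measurable => //.
by move=> i _; exact: measurable_preimage_RV.
Qed.

Lemma sigma_of_sub_cylinder u : sigma_of X u `<=` <<s cylinder u >>.
Proof.
apply: sub_sigma_algebra2 => A [j ju [B mB <-]].
exists (fun i => if i == j then B else setT); split.
  by move=> i; case: (i == j).
apply/seteqP; split => [w [_ Bw] i _ /=|w /(_ j ju)/=].
  by case: eqP => [->|].
by rewrite eqxx.
Qed.

(** A version of the conditional expectation of the product given the [X i] with [i] in [u]: the
    other factors are averaged out. *)
Definition partial_mean g u (w : T) : R :=
  \prod_i (if i \in u then g i (X i w) else \int[P]_w' g i (X i w')).

Lemma bounded_partial_mean g u : (forall i, bounded_measurable (g i)) ->
  bounded_measurable (partial_mean g u).
Proof.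
move=> bg; apply: bounded_measurable_prod => i; case: (i \in u).
  exact: (bounded_measurable_comp (measurable_funPT (X i))).
exact: bounded_measurable_cst.
Qed.

Hypothesis hX : mutually_independent X.

(** By the pi-lambda theorem cylinders suffice. The indicator of a cylinder is itself a product over
    coordinates, so both integrals factor, and outside [u] a mean integrates to itself. *)
Lemma is_cond_expectation_partial_mean g u :
  (forall i, bounded_measurable (g i)) ->
  is_cond_expectation P (sigma_of X u) (fun w => \prod_i g i (X i w))
    (partial_mean g u).
Proof.
move=> bg; have bgX i : bounded_measurable (fun w => g i (X i w)).
  exact: (bounded_measurable_comp (measurable_funPT (X i))).
have bY : bounded_measurable (fun w => \prod_i g i (X i w)).
  exact: bounded_measurable_prod.
have bZ := bounded_partial_mean u bg.
split; last 1 first.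
- move=> A /sigma_of_sub_cylinder; apply: eq_integral_g_sigma_algebra.
  + exact: cylinder_setI_closed.
  + exact: cylinder_measurable.
  + exact: cylinder_setT.
  + exact: bounded_measurable_integrable bZ.
  + exact: bounded_measurable_integrable bY.
  move=> {}A cA; have mA := cylinder_measurable cA.
  rewrite !EFin_Rintegral//; congr EFin.
  have [B [mB AE]] := cA.
  have indA w : \1_A w = \prod_i (if i \in u then \1_(B i) (X i w) else 1) :> R.
    rewrite indicE; have [/set_mem Aw|/negP nAw] := boolP (w \in A).
      rewrite big1// => i _; case: ifP => // iu.
      by rewrite indicE mem_set//; move: Aw; rewrite AE; exact.
    apply/esym/eqP; rewrite prodf_seq_eq0/=; apply/hasP.
    have : ~ A w by move=> /mem_set.
    rewrite AE => /existsNP[i /not_implyP[iu Hi]].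
    exists i; first exact: mem_index_enum.
    by rewrite (_ : i \in u = true)// indicE memNset.
  have bBg i : bounded_measurable (fun x => \1_(B i) x * g i x).
    by apply: bounded_measurableM => //; exact: bounded_measurable_indic.
  (* The factors with [i] in [u] absorb the indicator of [B i]; [phi] belongs to the full product
     and [psi] to its partial mean. *)
  pose phi i x := if i \in u then \1_(B i) x * g i x else g i x.
  pose psi i x := if i \in u then \1_(B i) x * g i x
    else \int[P]_w' g i (X i w').
  transitivity (\int[P]_w \prod_i psi i (X i w)).
    rewrite [LHS]Rintegral_mkcond; apply: eq_Rintegral => w _.
    rewrite patch_indic/= mulrC indA -big_split; apply: eq_bigr => i _ /=.
    by rewrite /psi; case: ifP; rewrite ?mul1r.
  transitivity (\int[P]_w \prod_i phi i (X i w)); last first.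
    rewrite [RHS]Rintegral_mkcond; apply: eq_Rintegral => w _.
    rewrite patch_indic /= [RHS]mulrC indA -big_split; apply: eq_bigr => i _ /=.
    by rewrite /phi; case: ifP; rewrite ?mul1r.
  rewrite !Rintegral_prod_indep//; last 2 first.
    by move=> i; rewrite /phi; case: (i \in u).
    by move=> i; rewrite /psi; case: (i \in u) => //; exact: bounded_measurable_cst.
  apply: eq_bigr => i _; rewrite /psi /phi; case: (i \in u) => //.
  exact: probability_Rintegral_cst.
- move=> B mB.
  pose T' := g_sigma_algebraType (gen u).
  (* The non-constant factors involve only the [X i] with [i] in [u], which are measurable for the
     sigma-algebra they generate. *)
  suff : measurable_fun setT (partial_mean g u : T' -> R).
    by move=> /(_ measurableT _ mB); rewrite setTI.
  apply: measurable_prod => i _; have [iu|//] := boolP (i \in u).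
  apply: measurableT_comp; first by case: (bg i).
  move=> _ C mC; apply: sub_sigma_algebra.
  by exists i => //; exists C.
- exact: bounded_measurable_integrable bZ.
Qed.

(** Since [partial_mean] is a version, [xget] chooses a version and not its default. Measurability
    is recorded for the later comparison of variances. *)
Lemma cond_expectation_prod_ae g u : (forall i, bounded_measurable (g i)) ->
  let Y w := \prod_i g i (X i w) in
  measurable_fun setT (cond_expectation P (sigma_of X u) Y) /\
  {ae P, forall w, cond_expectation P (sigma_of X u) Y w = partial_mean g u w}.
Proof.
move=> bg Y; have cZ := is_cond_expectation_partial_mean u bg.
have cY : is_cond_expectation P (sigma_of X u) Y
    (cond_expectation P (sigma_of X u) Y).
  by rewrite /cond_expectation; case: xgetP => [Y' _//|/(_ (partial_mean g u))].
split; last exact: (is_cond_expectation_ae_eq (@gen_measurable u) cY cZ).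
move=> _ B mB; rewrite setTI; have [+ _ _] := cY => /(_ _ mB).
apply: smallest_sub; [exact: sigma_algebra_measurable|exact: gen_measurable].
Qed.

Definition anova_prod g u (w : T) : R :=
  \prod_i (if i \in u then g i (X i w) - \int[P]_w' g i (X i w')
           else \int[P]_w' g i (X i w')).

(** Expand by distributivity the product of [(g i - m i) + m i] over [i] in [u] and of [0 + m i]
    elsewhere; the zeros kill every [v] not contained in [u]. *)
Lemma anova_prod_sum g u w :
  \sum_(v : {set I} | v \subset u) anova_prod g v w = partial_mean g u w.
Proof.
pose m i := \int[P]_w' g i (X i w').
transitivity (\sum_(v : {set I})
    \prod_i (if i \in v then (if i \in u then g i (X i w) - m i else 0)
             else m i)).
  rewrite big_mkcond/=; apply: eq_bigr => v _; case: ifPn => [vu|].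
    apply: eq_bigr => i _; case: ifP => // iv.
    by rewrite (fintype.subsetP vu _ iv).
  move=> /fintype.subsetPn[i iv iu].
  by rewrite (bigD1 i)//= iv (negbTE iu) mul0r.
rewrite -bigA_distr; apply: eq_bigr => i _.
by case: ifP => _ /=; [rewrite subrK|rewrite add0r].
Qed.

Lemma bounded_anova_prod g u : (forall i, bounded_measurable (g i)) ->
  bounded_measurable (anova_prod g u).
Proof.
move=> bg; apply: bounded_measurable_prod => i; case: (i \in u); last first.
  exact: bounded_measurable_cst.
apply: bounded_measurableB; last exact: bounded_measurable_cst.
exact: (bounded_measurable_comp (measurable_funPT (X i))).
Qed.

(** By [anova_prod_sum] the products satisfy the recursion that defines [anova], so strong induction
    on [#|u|] identifies the two. *)
Lemma anova_prod_ae g u : (forall i, bounded_measurable (g i)) ->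
  let Y w := \prod_i g i (X i w) in
  measurable_fun setT (anova X Y u) /\
  {ae P, forall w, anova X Y u w = anova_prod g u w}.
Proof.
move=> bg Y; have [n] := ubnP #|u|; elim: n u => // n IHn u /ltnSE un.
have IH v : v \proper u -> measurable_fun setT (anova X Y v) /\
    {ae P, forall w, anova X Y v w = anova_prod g v w}.
  by move=> vu; apply: IHn; exact: leq_trans (proper_card vu) un.
have [mc cE] := cond_expectation_prod_ae u bg.
split.
  have -> : anova X Y u = fun w => cond_expectation P (sigma_of X u) Y w -
      \sum_(v : {set I}) if v \proper u then anova X Y v w else 0.
    by apply/funext => w; rewrite anovaE [in LHS]big_mkcond.
  apply: measurable_funB => //; apply: measurable_sum => v.
  by have [vu|//] := boolP (v \proper u); have [] := IH v vu.
(* There are finitely many subsets, so one null set serves for all [v] at once. *)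
have sE : {ae P, forall w, forall v, v \proper u ->
    anova X Y v w = anova_prod g v w}.
  apply: filter_forall => v; case: (boolP (v \proper u)) => vu.
    by have [_] := IH v vu; apply: filterS.
  exact: aeW.
apply: filterS2 cE sE => w cE sE.
rewrite anovaE cE -anova_prod_sum (bigD1 u)//= (eq_bigr _ sE).
under eq_bigl => v do rewrite andbC -finset.properEneq.
by rewrite addrK.
Qed.

End Anova.

(** Write [#|u|] as the sum over [j] of the indicator of [j \in u] and exchange sums; replacing
    [b j] by 0 then removes the sets without [j]. Analytically this is the derivative at [z = 1] of
    [\prod_i (z * a i + b i)]. *)
Lemma sum_card_prod (R : comNzRingType) (I : finType) (a b : I -> R) :
  \sum_(u : {set I}) #|u|%:R * \prod_i (if i \in u then a i else b i) =
  \sum_j a j * \prod_(k | k != j) (a k + b k).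
Proof.
transitivity (\sum_(u : {set I}) \sum_j
    (j \in u)%:R * \prod_i (if i \in u then a i else b i)).
  apply: eq_bigr => u _; rewrite -mulr_suml; congr (_ * _).
  by rewrite -sum1_card big_mkcond natr_sum; apply: eq_bigr => j _; case: ifP.
rewrite exchange_big; apply: eq_bigr => j _ /=.
transitivity (\prod_i (a i + if i == j then 0 else b i)); last first.
  rewrite (bigD1 j)//= eqxx addr0; congr (_ * _).
  by apply: eq_bigr => i /negbTE ->.
rewrite bigA_distr; apply: eq_bigr => u _; have [ju|ju] := boolP (j \in u).
  rewrite mul1r; apply: eq_bigr => i _; case: ifPn => // iu.
  by case: eqP => // ij; rewrite -ij (negbTE iu) in ju.
by rewrite mul0r (bigD1 j)//= (negbTE ju) eqxx mul0r.
Qed.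

(** * Variances and the mean dimension of a product *)

Section MeanDimension.
Context (disp : measure_display) (T : measurableType disp) (R : realType).
Variable P : probability T R.

Lemma variance_Rintegral (f : T -> R) : bounded_measurable f ->
  'V_P[f] = (\int[P]_w ((f w - \int[P]_w' f w') ^+ 2))%:E.
Proof.
move=> bf; rewrite /variance unlock unlock -EFin_Rintegral//.
by apply: bounded_measurableM; apply: bounded_measurableB => //;
  exact: bounded_measurable_cst.
Qed.

Lemma variance_bounded_measurable (f : T -> R) : bounded_measurable f ->
  'V_P[f] = (\int[P]_w (f w ^+ 2) - (\int[P]_w f w) ^+ 2)%:E.
Proof.
move=> bf; rewrite variance_Rintegral//; set m := \int[P]_w f w.
have bff : bounded_measurable (fun w => f w ^+ 2) by exact: bounded_measurableM.
have bmf : bounded_measurable (fun w => m *+ 2 * f w).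
  by apply: bounded_measurableM => //; exact: bounded_measurable_cst.
transitivity ((\int[P]_w (f w ^+ 2 - m *+ 2 * f w + m ^+ 2))%:E).
  by congr EFin; apply: eq_Rintegral => w _; ring.
rewrite bounded_RintegralD; last 2 first.
- exact: bounded_measurableB.
- exact: bounded_measurable_cst.
rewrite bounded_RintegralB// bounded_RintegralZl// probability_Rintegral_cst -/m.
by congr EFin; ring.
Qed.

Lemma variance_ae_eq (f g : T -> R) :
  measurable_fun setT f -> measurable_fun setT g ->
  {ae P, forall w, f w = g w} -> 'V_P[f] = 'V_P[g].
Proof.
move=> mf mg fg; rewrite /variance !unlock.
have -> : (\int[P]_w (f w)%:E = \int[P]_w (g w)%:E)%E.
  apply: ae_eq_integral => //; [exact/measurable_EFinP..|].
  by apply: filterS fg => w + _ => ->.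
set m := fine _.
have mfun2 (h : T -> R) : measurable_fun setT h ->
    measurable_fun setT (EFin \o ((h \- cst m) * (h \- cst m))%R).
  by move=> mh; apply/measurable_EFinP; apply: measurable_funM; exact: measurable_funB.
apply: ae_eq_integral => //; [exact: mfun2..|].
by apply: filterS fg => w + _ /=; rewrite /GRing.mul /= => ->.
Qed.

Variables (I : finType) (X : I -> {RV P >-> R}) (g : I -> R -> R).
Hypothesis hX : mutually_independent X.
Hypothesis bg : forall i, bounded_measurable (g i).

Let m i := \int[P]_w g i (X i w).
Let s i := \int[P]_w (g i (X i w) ^+ 2).

Let bgX i : bounded_measurable (fun w => g i (X i w)).
Proof. exact: (bounded_measurable_comp (measurable_funPT (X i))). Qed.

Let bg2 i : bounded_measurable (fun x => g i x ^+ 2).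
Proof. exact: bounded_measurableM. Qed.

Lemma variance_prod_indep :
  'V_P[fun w => \prod_i g i (X i w)] = (\prod_i s i - \prod_i m i ^+ 2)%:E.
Proof.
rewrite variance_bounded_measurable; last exact: bounded_measurable_prod.
rewrite Rintegral_prod_indep// -prodrXl; congr (_ - _)%:E.
rewrite -(Rintegral_prod_indep hX bg2).
by apply: eq_Rintegral => w _; rewrite prodrXl.
Qed.

(** A factor with index in [u] is centred, so the product has mean 0 and its variance is its second
    moment, which factors by independence. *)
Lemma variance_anova_prod (u : {set I}) : u != finset.set0 ->
  'V_P[anova_prod X g u] =
  (\prod_i (if i \in u then s i - m i ^+ 2 else m i ^+ 2))%:E.
Proof.
move=> /set0Pn[j ju]; pose f i x := if i \in u then g i x - m i else m i.
have bf i : bounded_measurable (f i).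
  rewrite /f; case: (i \in u); last exact: bounded_measurable_cst.
  by apply: bounded_measurableB => //; exact: bounded_measurable_cst.
have fE w : anova_prod X g u w = \prod_i f i (X i w) by [].
rewrite variance_bounded_measurable; last exact: bounded_anova_prod.
under [X in _ - X ^+ 2]eq_Rintegral do rewrite fE.
rewrite (Rintegral_prod_indep hX bf) [X in _ - X ^+ 2](bigD1 j)//=.
have -> : \int[P]_w f j (X j w) = 0.
  rewrite /f ju bounded_RintegralB//; last exact: bounded_measurable_cst.
  by rewrite probability_Rintegral_cst subrr.
rewrite mul0r expr0n subr0; congr EFin.
transitivity (\int[P]_w \prod_i (f i (X i w) ^+ 2)).
  by apply: eq_Rintegral => w _; rewrite fE prodrXl.
rewrite (@Rintegral_prod_indep _ _ _ _ _ _ (fun i x => f i x ^+ 2))//; last first.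
  by move=> i; exact: bounded_measurableM.
apply: eq_bigr => i _; rewrite /f; case: ifP => _; last first.
  exact: probability_Rintegral_cst.
by apply: EFin_inj; rewrite -variance_bounded_measurable// variance_Rintegral.
Qed.

End MeanDimension.

(** The sum is [sum_card_prod] with [a = s - m ^+ 2] and [b = m ^+ 2], for which [a + b = s]. *)
Lemma mean_dimension_prod (disp : measure_display) (T : measurableType disp)
    (R : realType) (P : probability T R) (d : nat) (X : 'I_d -> {RV P >-> R})
    (g : 'I_d -> R -> R) : mutually_independent X ->
  (forall j, bounded_measurable (g j)) ->
  let m j := \int[P]_w g j (X j w) in
  let s j := \int[P]_w (g j (X j w) ^+ 2) in
  mean_dimension X (fun x => \prod_j g j (x 0 j)) =
  ((\prod_j s j - \prod_j m j ^+ 2)^-1 *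
   \sum_j (s j - m j ^+ 2) * \prod_(k | k != j) s k)%:E.
Proof.
move=> hX bg m s; rewrite /mean_dimension.
have -> : (fun w => \prod_j g j ((\row_j X j w) 0 j)) =
    (fun w => \prod_j g j (X j w)).
  by apply/funext => w; apply: eq_bigr => j _; rewrite mxE.
rewrite variance_prod_indep//= EFinM; congr (_ * _)%E.
transitivity ((\sum_(u : {set 'I_d}) #|u|%:R *
    \prod_i (if i \in u then s i - m i ^+ 2 else m i ^+ 2))%:E); last first.
  rewrite sum_card_prod; congr EFin; apply: eq_bigr => j _; congr (_ * _).
  by apply: eq_bigr => k _; rewrite subrK.
rewrite -sumEFin; apply: eq_bigr => u _.
(* The variance formula excludes the empty set, whose weight is 0. *)
have [->|u0] := eqVneq u finset.set0; first by rewrite cards0 mul0e mul0r.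
rewrite EFinM -variance_anova_prod//; congr (_ * _)%E.
have [mA AE] := anova_prod_ae hX u bg.
by apply: variance_ae_eq => //; have [] := bounded_anova_prod X u bg.
Qed.

(** * Gaussian means *)

Section GaussianKernel.
Variable R : realType.

(* The absolute value keeps the kernel bounded by 1, hence its means continuous, for all [t]. *)
Definition gauss (c t x : R) : R := expR (- (`|t| * (x - c) ^+ 2)).

Lemma gauss_gt0 c t x : 0 < gauss c t x. Proof. exact: expR_gt0. Qed.

Lemma gauss_le1 c t x : gauss c t x <= 1.
Proof. by rewrite -expR0 ler_expR oppr_le0 mulr_ge0// sqr_ge0. Qed.

Lemma gauss0 c x : gauss c 0 x = 1.
Proof. by rewrite /gauss normr0 mul0r oppr0 expR0. Qed.

Lemma gauss_sqr c t x : gauss c t x ^+ 2 = gauss c (t *+ 2) x.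
Proof. by rewrite /gauss expr2 -expRD normrMn; congr expR; ring. Qed.

Lemma measurable_gauss c t : measurable_fun setT (gauss c t).
Proof.
apply: measurableT_comp => //; apply: measurableT_comp => //=.
apply: measurable_funM => //; apply: measurable_funX => //=.
exact: measurable_funB.
Qed.

Lemma bounded_gauss c t : bounded_measurable (gauss c t).
Proof.
split; first exact: measurable_gauss.
by exists 1 => x; rewrite gtr0_norm ?gauss_gt0 ?gauss_le1.
Qed.

Lemma continuous_gauss c x : continuous (fun t => gauss c t x).
Proof.
move=> t; apply: continuous_comp; last exact: continuous_expR.
apply: cvgN; apply: cvgM; last exact: cvg_cst.
exact: norm_continuous.
Qed.

Lemma integral_gauss c t : 0 < t ->
  (\int[lebesgue_measure]_x (gauss c t x)%:E = (Num.sqrt (pi / t))%:E)%E.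
Proof.
(* The standard deviation with [s ^+ 2 = 1 / (2t)], for which the normal density centred at [c] is
   the kernel times its peak. *)
move=> t0; pose s := Num.sqrt ((t *+ 2)^-1).
have s0 : s != 0 by rewrite gt_eqF// sqrtr_gt0 invr_gt0 pmulrn_lgt0.
have s2 : s ^+ 2 = (t *+ 2)^-1 by rewrite sqr_sqrtr// invr_ge0 mulrn_wge0// ltW.
have peakE : (normal_peak s)^-1 = Num.sqrt (pi / t).
  rewrite /normal_peak invrK s2; congr Num.sqrt.
  by rewrite -[t *+ 2]mulr_natr; field; rewrite gt_eqF.
have gaussE x : gauss c t x = (normal_peak s)^-1 * normal_pdf c s x.
  rewrite /normal_pdf (negbTE s0) /= mulrA mulVf ?mul1r; last first.
    by rewrite gt_eqF// normal_peak_gt0.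
  rewrite /normal_fun /gauss s2 gtr0_norm//; congr expR.
  by rewrite -[t *+ 2]mulr_natr -[_ *+ 2]mulr_natr; field; rewrite gt_eqF.
under eq_integral do rewrite gaussE EFinM.
rewrite ge0_integralZl//; last 3 first.
- by apply/measurable_EFinP; exact: measurable_normal_pdf.
- by move=> x _; rewrite lee_fin normal_pdf_ge0.
- by rewrite lee_fin invr_ge0 normal_peak_ge0.
by rewrite integral_normal_pdf mule1 peakE.
Qed.

End GaussianKernel.

(* A set of measure [eta] inside the interval, on the side of [c] where the interval has room. *)
Lemma interval_room (R : realType) (J : interval R) (c : R) :
  (0 < lebesgue_measure [set` J])%E -> c \in J ->
  exists2 a : R, 0 < a & forall eta, 0 < eta <= a -> exists S : set R,
    [/\ measurable S, lebesgue_measure S = eta%:E, S `<=` [set` J] &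
        forall x, S x -> (x - c) ^+ 2 <= eta ^+ 2].
Proof.
move=> J0 cJ.
(* A point has measure 0, so [J] contains a second point [x], and by convexity the segment between
   [c] and [x]. *)
have [x xJ xc] : exists2 x, x \in J & x != c.
  apply: contrapT => H; move: J0; rewrite ltNge => /negP; apply.
  apply: (@le_trans _ _ (lebesgue_measure [set c])).
    apply: le_measure; rewrite ?inE /=; [by []|exact: measurable_set1|].
    move=> y /= yJ; apply: contrapT => /eqP yc; apply: H; exists y => //.
  by rewrite lebesgue_measure_set1.
have Jconv := @interval_is_interval _ J.
have [cx|xc'] : c < x \/ x < c by case: (ltgtP c x) xc => // *; [left|right].
- exists (x - c); first by rewrite subr_gt0.
  move=> eta /andP[eta0 etax]; exists `[c, c + eta]%classic; split => //.
  + by rewrite lebesgue_measure_itv/= lte_fin ltrDl eta0 -EFinD addrAC subrr add0r.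
  + move=> y /=; rewrite in_itv/= => /andP[cy yc]; apply: (Jconv c x cJ xJ y).
    by rewrite cy/=; lra.
  + by move=> y /=; rewrite in_itv/= => /andP[cy yc]; rewrite ler_sqr ?nnegrE; lra.
- exists (c - x); first by rewrite subr_gt0.
  move=> eta /andP[eta0 etax]; exists `[c - eta, c]%classic; split => //.
  + rewrite lebesgue_measure_itv/= lte_fin ltrBlDr ltrDl eta0 -EFinD.
    by congr EFin; lra.
  + move=> y /=; rewrite in_itv/= => /andP[cy yc]; apply: (Jconv x c xJ cJ y).
    by rewrite yc andbT; lra.
  + move=> y /=; rewrite in_itv/= => /andP[cy yc].
    by rewrite -sqrrN ler_sqr ?nnegrE; lra.
Qed.

Section LaplaceGauss.
Context (disp : measure_display) (T : measurableType disp) (R : realType).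
Variables (P : probability T R) (X : {RV P >-> R}) (c : R) (h : R -> R).
Hypothesis Xh : has_density X h.

(** For [t >= 0], the Laplace transform of [(X - c) ^+ 2]; by [gauss_sqr], its value at [2t] is the
    second moment of the kernel at [t]. *)
Definition mean_gauss (t : R) : R := \int[P]_w gauss c t (X w).

Lemma bounded_gauss_RV t : bounded_measurable (fun w => gauss c t (X w)).
Proof.
exact: (bounded_measurable_comp (measurable_funPT X) (bounded_gauss c t)).
Qed.

Lemma mean_gauss0 : mean_gauss 0 = 1.
Proof.
rewrite -[RHS](probability_Rintegral_cst P).
by apply: eq_Rintegral => w _; rewrite gauss0.
Qed.

(** Dominated convergence, with the constant 1 as bound. *)
Lemma continuous_mean_gauss : continuous mean_gauss.
Proof.
move=> t; have := @continuity_under_integral R _ T P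
  (fun t w => gauss c t (X w)) setT measurableT (t - 1) (t + 1).
move=> /(_ _ _ (fun=> 1)); apply => //.
- by move=> s _; apply: bounded_measurable_integrable => //; exact: bounded_gauss_RV.
- by apply: aeW => w _ s _; exact: continuous_gauss.
- exact: (bounded_measurable_integrable _ measurableT (bounded_measurable_cst _ 1)).
- by move=> s _; apply: aeW => w _; rewrite gtr0_norm ?gauss_gt0 ?gauss_le1.
- by rewrite inE/= in_itv/= ltrBlDr ltrDl ltr01.
Qed.

(** [X] lies in [S] with probability at least [delta * eta], and on that event the kernel is at
    least the exponential factor. *)
Lemma mean_gauss_ge (delta eta t : R) (S : set R) : 0 <= eta -> 0 <= delta ->
  measurable S -> lebesgue_measure S = eta%:E ->
  (forall x, S x -> delta <= h x) ->
  (forall x, S x -> (x - c) ^+ 2 <= eta ^+ 2) ->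
  expR (- (`|t| * eta ^+ 2)) * (delta * eta) <= mean_gauss t.
Proof.
move=> eta0 delta0 mS muS hS cS; have [mh h0 PXh] := Xh.
have mXS : measurable (X @^-1` S).
  by rewrite -[X in measurable X]setTI; exact: measurable_funPT.
have PS : delta * eta <= fine (P (X @^-1` S)).
  rewrite -lee_fin fineK ?fin_num_measure// [leRHS](PXh S mS) EFinM -muS.
  rewrite -integral_cst//; apply: ge0_le_integral => //.
  - by apply/measurable_EFinP; exact: measurable_funTS.
set b := expR _.
have b0 : 0 <= b by exact: expR_ge0.
apply: le_trans (ler_wpM2l b0 PS) _.
have bS : bounded_measurable (\1_(X @^-1` S) : T -> R).
  exact: bounded_measurable_indic.
rewrite -(Rintegral_indic P mXS) -bounded_RintegralZl//.
apply: le_Rintegral => //.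
- apply: (@bounded_measurable_integrable _ _ _ P (fun w => b * \1_(X @^-1` S) w)) => //.
  by apply: bounded_measurableM => //; exact: bounded_measurable_cst.
- by apply: bounded_measurable_integrable => //; exact: bounded_gauss_RV.
- move=> w _; rewrite indicE; have [/set_mem Sw|_] := boolP (_ \in _); last first.
    by rewrite mulr0 ltW ?gauss_gt0.
  by rewrite mulr1 ler_expR lerN2 ler_wpM2l// cS.
Qed.

(** The bound on the density makes the law of [X] at most [M] times Lebesgue measure, against which
    the kernel is integrated. *)
Lemma mean_gauss_le (M t : R) : (forall x, h x <= M) -> 0 < t ->
  mean_gauss t <= M * Num.sqrt (pi / t).
Proof.
move=> hM t0; have [mh h0 PXh] := Xh.
have M0 : 0 <= M := le_trans (h0 0) (hM 0).
(* [RL] is the real line as the measurable space carrying [lebesgue_measure]; the law of [X] is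
   rebuilt on it as [Q], so that the two measures can be compared. *)
pose RL := measurableTypeR R.
have mg : measurable_fun setT (fun x : RL => (gauss c t x)%:E).
  by apply/measurable_EFinP; exact: measurable_gauss.
have g0 (x : RL) : (0 <= (gauss c t x)%:E)%E by rewrite lee_fin ltW ?gauss_gt0.
have mX : measurable_fun setT (X : T -> RL).
  by move=> _ B mB; exact: (measurable_funPT X measurableT (B : set R) mB).
pose Q : {measure set RL -> \bar R} :=
  measure_function_pushforward__canonical__measure_function_Measure P mX.
rewrite -lee_fin -EFin_Rintegral//; last exact: bounded_gauss_RV.
have -> : (\int[P]_w (gauss c t (X w))%:E = \int[Q]_x (gauss c t x)%:E)%E.
  by rewrite (ge0_integral_pushforward mX)//; exact: measurable_funTS.
pose k : {nonneg R} := NngNum M0.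
pose kmu : {measure set RL -> \bar R} := mscale k (@lebesgue_measure R).
have le_dist (S : set RL) : measurable S -> (Q S <= kmu S)%E.
  move=> mS; rewrite [leLHS](PXh S mS) /kmu/= /mscale/= -integral_cst//.
  apply: ge0_le_integral => //.
  - by move=> x _; rewrite lee_fin.
  - by apply/measurable_EFinP; exact: measurable_funTS.
  - by move=> x _; rewrite lee_fin.
apply: le_trans (ge0_le_measure_integral le_dist measurableT g0 mg) _.
by rewrite ge0_integral_mscale// integral_gauss// EFinM.
Qed.

(* Equality would make the Gaussian of [X] almost surely constant, hence [X] almost
   surely one of two points, which has probability 0 as [X] has a density. *)
Lemma mean_gauss_sqr_lt t : 0 < t -> mean_gauss t ^+ 2 < mean_gauss (t *+ 2).
Proof.
move=> t0; have [mh h0 PXh] := Xh; set m := mean_gauss t.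
have bg := bounded_gauss_RV t.
have bgm : bounded_measurable (fun w => gauss c t (X w) - m).
  by apply: bounded_measurableB => //; exact: bounded_measurable_cst.
have bgm2 : bounded_measurable (fun w => (gauss c t (X w) - m) ^+ 2).
  exact: bounded_measurableM.
have varE : \int[P]_w ((gauss c t (X w) - m) ^+ 2) =
    mean_gauss (t *+ 2) - m ^+ 2.
  have := variance_Rintegral P bg; rewrite -/(mean_gauss t) -/m.
  rewrite variance_bounded_measurable// -/(mean_gauss t) -/m => -[<-].
  by congr (_ - _); apply: eq_Rintegral => w _; rewrite gauss_sqr.
rewrite -subr_gt0 -varE lt_neqAle Rintegral_ge0 ?andbT; last by move=> w _; exact: sqr_ge0.
apply/eqP => var0.
have : {ae P, forall w, gauss c t (X w) = m}.
  have : (\int[P]_w `|((gauss c t (X w) - m) ^+ 2)%:E| = 0)%E.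
    under eq_integral do rewrite gee0_abs ?lee_fin ?sqr_ge0//.
    by rewrite EFin_Rintegral// -var0.
  have mg2 : measurable_fun setT (fun w => ((gauss c t (X w) - m) ^+ 2)%:E).
    by apply/measurable_EFinP; case: bgm2.
  move=> /(ae_eq_integral_abs P measurableT mg2).
  apply: filterS => w /(_ I) [] /eqP.
  by rewrite sqrf_eq0 subr_eq0 => /eqP.
pose B := [set x | gauss c t x = m].
have mB : measurable B.
  by rewrite -[B]setTI; exact: (measurable_gauss c t measurableT (measurable_set1 m)).
have muB : lebesgue_measure B = 0%E.
  apply: countable_lebesgue_measure0.
  have [->|/set0P[x0 Bx0]] := eqVneq B set0; first exact: countable0.
  (* Equal values of the kernel mean equal distances to [c], so only [x0] and its reflection in [c]
     can occur. *)
  apply: (@sub_countable _ _ _ [set x0; c *+ 2 - x0]); last first.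
    by apply: finite_set_countable; rewrite finite_setU; split; exact: finite_set1.
  apply: subset_card_le => x Bx /=.
  move: Bx; rewrite /B /= -Bx0 => /expR_inj/oppr_inj.
  move=> /(mulfI (lt0r_neq0 _)) => /(_ _)/eqP.
  rewrite normr_gt0 gt_eqF// => /(_ isT); rewrite eqf_sqr => /orP[]/eqP H.
    by left; lra.
  by right; lra.
have PB : P (X @^-1` B) = 0%E.
  rewrite -[LHS]/(distribution P X B) PXh// null_set_integral//.
  by apply/measurable_EFinP; exact: measurable_funTS.
have mXB : measurable (X @^-1` B).
  by rewrite -[X in measurable X]setTI; exact: measurable_funPT.
move=> [N [mN PN0 HN]].
have : P (~` (X @^-1` B)) = 0%E by exact: (subset_measure0 (measurableC mXB) mN HN PN0).
rewrite probability_setC// PB sube0 => /eqP; rewrite gt_eqF//.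
Qed.

End LaplaceGauss.

(** * The intermediate value argument *)

Lemma sum_compl_prod_le (R : realFieldType) (I : Type) (s : seq I) (r : I -> R) :
  (forall i, 0 <= r i <= 1) ->
  (\sum_(i <- s) (1 - r i)) * \prod_(i <- s) r i <= 1 - \prod_(i <- s) r i.
Proof.
move=> r01; elim: s => [|i s IHs]; first by rewrite !big_nil mul0r subrr.
rewrite !big_cons; have /andP[ri0 ri1] := r01 i.
set S := \sum_(j <- s) _ in IHs *; set p := \prod_(j <- s) _ in IHs *.
have p0 : 0 <= p by apply: prodr_ge0 => j _; case/andP: (r01 j).
have p1 : p <= 1 by apply: Num.Theory.prodr_ile1 => j _; exact: r01.
(* The left side of the claim is the sum of the two left sides below: the induction hypothesis
   scaled by [r i] bounds one, and [r i * p <= 1] the other. *)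
have h1 : r i * (S * p) <= r i * (1 - p) by exact: ler_wpM2l.
have h2 : (1 - r i) * (r i * p) <= (1 - r i) * 1.
  by apply: ler_wpM2l; [lra|exact: mulr_ile1].
lra.
Qed.

Lemma exists_compl_ratio (R : realType) (d : nat) (r : 'I_d -> R -> R) (m : R) :
  (forall j, continuous (r j)) -> (forall j, r j 0 = 1) ->
  (forall j t, 0 < t -> 0 < r j t < 1) ->
  (forall j e, 0 < e -> exists t0, forall t, t0 < t -> r j t < e) ->
  1 < m -> m < d%:R ->
  exists2 t, 0 < t & \prod_j r j t < 1 /\
    \sum_j (1 - r j t) = m * (1 - \prod_j r j t).
Proof.
move=> cr r0 r01 roo m1 md.
have d0 : (0 < d)%N by rewrite -(ltr_nat R); lra.
have rle t : 0 < t -> forall j, 0 <= r j t <= 1.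
  by move=> t0 j; have /andP[? ?] := r01 j t t0; rewrite !ltW.
have S0 t : 0 < t -> 0 < \sum_j (1 - r j t).
  move=> t0; rewrite (bigD1 (Ordinal d0))//= ltr_wpDr//.
    by apply: sumr_ge0 => j _; have /andP[_ ?] := r01 j t t0; rewrite subr_ge0 ltW.
  by have /andP[_ ?] := r01 (Ordinal d0) t t0; rewrite subr_gt0.
have p0 t : 0 < t -> 0 < \prod_j r j t.
  by move=> t0; apply: prodr_gt0 => j _; have /andP[] := r01 j t t0.
pose H t := \sum_j (1 - r j t) - m * (1 - \prod_j r j t).
have cp : continuous (fun t => \prod_j r j t).
  by apply: continuous_big => //; exact: mul_continuous.
have cS : continuous (fun t => \sum_j (1 - r j t)).
  apply: continuous_big => [|j _ s]; first exact: add_continuous.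
  by apply: cvgB; [exact: cvg_cst|exact: cr].
have cH : continuous H.
  move=> t; apply: cvgB; first exact: cS.
  by apply: cvgM; [exact: cvg_cst|apply: cvgB; [exact: cvg_cst|exact: cp]].
(* [H] vanishes at 0, so a left endpoint [t1 > 0] is needed. Where the product [p] exceeds [1 / m],
   the sum [S] satisfies [S < m * (S * p) <= m * (1 - p)]. *)
have [t1 t10 Ht1] : exists2 t1, 0 < t1 & H t1 < 0.
  have : \forall t \near 0, m^-1 < \prod_j r j t.
    apply: (cvgr_gt _ (cp 0)); rewrite big1 ?invf_lt1//; lra.
  move=> /nbhs_ballP[e /= e0 He]; exists (e / 2); first by rewrite divr_gt0.
  have e20 : 0 < e / 2 by rewrite divr_gt0.
  have pm : m^-1 < \prod_j r j (e / 2).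
    by apply: He; rewrite /ball/= sub0r normrN gtr0_norm//; lra.
  have := sum_compl_prod_le (index_enum 'I_d) (rle _ e20).
  have := S0 _ e20; rewrite /H.
  set S := \sum_j _; set p := \prod_j _ in pm * => Spos Sp.
  have m0 : 0 < m by lra.
  have : S < m * (S * p).
    rewrite mulrCA -[ltLHS]mulr1 ltr_pM2l//.
    by rewrite mulrC -ltr_pdivrMr// div1r.
  have : m * (S * p) <= m * (1 - p) by rewrite ler_pM2l.
  lra.
have [t2 t12 Ht2] : exists2 t2, t1 < t2 & 0 < H t2.
  (* If all [d] ratios are below [(d - m) / d], they add up to less than [d - m], so the sum in [H]
     exceeds [m]. *)
  have e0 : 0 < (d%:R - m) / d%:R by rewrite divr_gt0 ?ltr0n// subr_gt0.
  have /choice[t0 Ht0] : forall j, exists t0, forall t, t0 < t -> r j t < (d%:R - m) / d%:R.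
    by move=> j; exact: roo.
  pose t2 := 1 + t1 + \sum_j `|t0 j|.
  have t12 : t1 < t2.
    by rewrite /t2 -addrA addrCA ltrDl ltr_wpDr// sumr_ge0.
  have t20 : 0 < t2 by exact: lt_trans t12.
  exists t2 => //.
  have rj j : r j t2 < (d%:R - m) / d%:R.
    apply: Ht0; rewrite /t2 (bigD1 j)//=.
    have : 0 <= \sum_(i < d | i != j) `|t0 i| by exact: sumr_ge0.
    have := ler_norm (t0 j); lra.
  have : m < \sum_j (1 - r j t2).
    rewrite sumrB sumr_const card_ord ltrBrDl -ltrBrDr.
    have -> : d%:R - m = \sum_(j < d) (d%:R - m) / d%:R.
      by rewrite sumr_const card_ord -[RHS]mulr_natr divfK// pnatr_eq0 -lt0n.
    apply: Num.Theory.ltr_sum => //; apply/hasP; exists (Ordinal d0) => //.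
  have : 0 < m * \prod_j r j t2 by rewrite mulr_gt0 ?p0//; lra.
  rewrite /H; lra.
have [t] : exists2 t, t \in `[t1, t2] & H t = 0.
  apply: IVT; [exact: ltW|exact: continuous_subspaceT|].
  by rewrite ge_min le_max (ltW Ht1) (ltW Ht2) orbT.
rewrite in_itv/= => /andP[tt1 _] /eqP; rewrite subr_eq0 => /eqP Ht.
have t0 : 0 < t := lt_le_trans t10 tt1.
exists t => //; split => //.
(* For the sum [S] and the product [p] at [t], [0 < S * p <= 1 - p]. *)
rewrite -subr_gt0; apply: lt_le_trans (sum_compl_prod_le _ (rle _ t0)).
by rewrite mulr_gt0 ?S0 ?p0.
Qed.

(** * The ratio of squared mean to second moment *)

Section GaussRatio.
Context (disp : measure_display) (T : measurableType disp) (R : realType).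
Variables (P : probability T R) (X : {RV P >-> R}) (c : R) (h : R -> R).
Hypothesis Xh : has_density X h.
Variables (J : interval R) (delta : R).
Hypotheses (J0 : (0 < lebesgue_measure [set` J])%E) (cJ : c \in J).
Hypotheses (delta0 : 0 < delta) (hJ : forall x, x \in J -> delta <= h x).

Local Notation L := (mean_gauss X c).

(** [eta] stays free: [eta = a] gives positivity, and [eta = 1 / sqrt t] the decay of the ratio. *)
Lemma mean_gauss_lower : exists2 a : R, 0 < a & forall eta t, 0 < eta <= a ->
  expR (- (`|t| * eta ^+ 2)) * (delta * eta) <= L t.
Proof.
have [a a0 room] := interval_room J0 cJ; exists a => // eta t etaa.
have [S [mS muS SJ Sc]] := room eta etaa; have /andP[eta0 _] := etaa.
by apply: (mean_gauss_ge Xh t _ _ mS muS) => //; [exact: ltW..|move=> x /SJ /hJ].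
Qed.

Lemma mean_gauss_gt0 t : 0 < L t.
Proof.
have [a a0 La] := mean_gauss_lower.
apply: lt_le_trans (La a t _); last by rewrite a0 lexx.
by rewrite mulr_gt0 ?expR_gt0 ?mulr_gt0.
Qed.

Definition gauss_ratio t : R := L t ^+ 2 / L (t *+ 2).

Lemma gauss_ratio0 : gauss_ratio 0 = 1.
Proof. by rewrite /gauss_ratio mul0rn mean_gauss0 expr1n divr1. Qed.

Lemma continuous_gauss_ratio : continuous gauss_ratio.
Proof.
move=> t; have cL : continuous L by exact: continuous_mean_gauss.
apply: cvgM; first by apply: cvgM; exact: cL.
apply: cvgV; first by rewrite gt_eqF ?mean_gauss_gt0.
apply: (@continuous_comp _ _ _ (fun t : R => t *+ 2) L); last exact: cL.
by apply: cvgD; exact: cvg_id.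
Qed.

Lemma gauss_ratio_itv t : 0 < t -> 0 < gauss_ratio t < 1.
Proof.
move=> t0; rewrite divr_gt0 ?exprn_gt0 ?mean_gauss_gt0//=.
by rewrite ltr_pdivrMr ?mean_gauss_gt0// mul1r (mean_gauss_sqr_lt _ Xh).
Qed.

(* With [eta = 1 / sqrt t], the numerator is O(eta^2) and the denominator at least a multiple
   of [eta]. *)
Lemma gauss_ratio_small (M e : R) : (forall x, h x <= M) -> 0 < e ->
  exists t0, forall t, t0 < t -> gauss_ratio t < e.
Proof.
move=> hM e0; have [a a0 La] := mean_gauss_lower.
have M0 : 0 <= M by apply: le_trans (hM c); rewrite ltW// (lt_le_trans delta0)// hJ.
(* The numerator is at most [M ^+ 2 * pi / t] and the denominator at least
   [expR (- 2) * delta / sqrt t], where the exponent comes from [2t * eta ^+ 2 = 2]; so the ratio is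
   at most [K / sqrt t]. *)
pose K := M ^+ 2 * pi / (expR (- 2) * delta).
have K0 : 0 <= K.
  by rewrite divr_ge0 ?mulr_ge0 ?sqr_ge0 ?expR_ge0 ?pi_ge0 ?(ltW delta0).
(* Then [sqrt t] exceeds [K / e], which makes [K / sqrt t] less than [e], and exceeds [1 / a], which
   makes [eta = 1 / sqrt t] admissible. *)
exists ((K / e + a^-1) ^+ 2) => t tt0.
have Ka0 : 0 < K / e + a^-1 by rewrite ltr_wpDl ?invr_gt0// divr_ge0// ltW.
have t0 : 0 < t by apply: le_lt_trans tt0; rewrite sqr_ge0.
set q := Num.sqrt t; have q0 : 0 < q by rewrite sqrtr_gt0.
have q2 : q ^+ 2 = t by rewrite sqr_sqrtr// ltW.
have qK : K / e + a^-1 < q by rewrite -(ltr_pXn2r (n := 2))// ?nnegrE ?ltW// q2.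
have up : L t ^+ 2 <= M ^+ 2 * (pi / t).
  rewrite -(@sqr_sqrtr _ (pi / t)); last by rewrite divr_ge0 ?pi_ge0 ?ltW.
  rewrite -exprMn ler_sqr ?nnegrE ?(ltW (mean_gauss_gt0 _)) ?mulr_ge0 ?sqrtr_ge0//.
  exact: (mean_gauss_le c Xh hM t0).
have lo : expR (- 2) * (delta * q^-1) <= L (t *+ 2).
  apply: le_trans (La q^-1 (t *+ 2) _).
    rewrite ler_pM2r ?mulr_gt0 ?invr_gt0// ler_expR lerN2.
    rewrite exprVn q2 gtr0_norm ?pmulrn_lgt0// -[t *+ 2]mulr_natl mulfK ?gt_eqF//.
  rewrite invr_gt0 q0/= -[leRHS]invrK lef_pV2 ?posrE ?invr_gt0// ltW//.
  by apply: le_lt_trans qK; rewrite lerDr divr_ge0// ltW.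
have lo0 : 0 < expR (- 2) * (delta * q^-1) by rewrite !mulr_gt0 ?expR_gt0 ?invr_gt0.
rewrite ltr_pdivrMr ?mean_gauss_gt0//; apply: le_lt_trans up _.
apply: lt_le_trans (ler_wpM2l (ltW e0) lo).
have -> : M ^+ 2 * (pi / t) = (K / q) * (expR (- 2) * (delta * q^-1)).
  by rewrite /K -q2; field; rewrite !gt_eqF ?expR_gt0.
rewrite ltr_pM2r// ltr_pdivrMr// mulrC -ltr_pdivrMr//.
by apply: lt_trans qK; rewrite ltrDl invr_gt0.
Qed.

End GaussRatio.

(** * Choice of the width and computation of the mean dimension *)

Theorem mainTheorem3 (R : realType) (disp : measure_display)
  (T : measurableType disp) (P : probability T R)
  (d : nat) (hd : (2 <= d)%N) (c : 'rV[R]_d)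
  (X : 'I_d -> {RV P >-> R}) (hX : mutually_independent X)
  (h : 'I_d -> R -> R) (hh : forall j, has_density (X j) (h j))
  (hbnd : forall j, exists M : R, forall x, h j x <= M)
  (I : 'I_d -> interval R)
  (hI : forall j, (0 < lebesgue_measure [set` I j])%E)
  (hcI : forall j, c 0 j \in I j)
  (hlow : forall j, exists2 delta : R, 0 < delta &
            forall x, x \in I j -> delta <= h j x)
  (m : R) (hm1 : 1 < m) (hmd : m < d%:R) :
  exists2 theta : R, 0 < theta &
    mean_dimension X (gaussian_rbf c theta) = m%:E.
Proof.
pose r j := gauss_ratio (X j) (c 0 j).
have L0 j t : 0 < mean_gauss (X j) (c 0 j) t.
  have [delta delta0 hdelta] := hlow j.
  exact: (mean_gauss_gt0 (hh j) (hI j) (hcI j) delta0 hdelta).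
have [t t0 [p1 tE]] : exists2 t, 0 < t & \prod_j r j t < 1 /\
    \sum_j (1 - r j t) = m * (1 - \prod_j r j t).
  apply: exists_compl_ratio => // j; have [delta delta0 hdelta] := hlow j.
  - exact: (continuous_gauss_ratio (hh j) (hI j) (hcI j) delta0 hdelta).
  - exact: gauss_ratio0.
  - exact: (gauss_ratio_itv (hh j) (hI j) (hcI j) delta0 hdelta).
  - move=> e e0; have [M hM] := hbnd j.
    exact: (gauss_ratio_small (hh j) (hI j) (hcI j) delta0 hdelta hM e0).
exists (Num.sqrt t)^-1; first by rewrite invr_gt0 sqrtr_gt0.
have -> : gaussian_rbf c (Num.sqrt t)^-1 =
    fun x => \prod_j gauss (c 0 j) t (x 0 j).
  apply/funext => x; apply: eq_bigr => j _; rewrite /gauss; congr expR.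
  by rewrite exprVn sqr_sqrtr ?ltW// invrK gtr0_norm// mulNr mulrC.
rewrite (@mean_dimension_prod _ _ _ _ _ _ (fun j => gauss (c 0 j) t))//=; last first.
  by move=> j; exact: bounded_gauss.
pose s j := mean_gauss (X j) (c 0 j) (t *+ 2).
have sE j : \int[P]_w (gauss (c 0 j) t (X j w) ^+ 2) = s j.
  by apply: eq_Rintegral => w _; rewrite gauss_sqr.
have mE j : (\int[P]_w gauss (c 0 j) t (X j w)) ^+ 2 = r j t * s j.
  by rewrite /r /gauss_ratio divfK// gt_eqF.
under [X in (X - _)^-1]eq_bigr do rewrite sE.
under [X in (_ - X)^-1]eq_bigr do rewrite mE.
(* Variance and weighted sum share the factor [\prod_j s j]: they are [1 - \prod_j r j t] and
   [\sum_j (1 - r j t)] times it. *)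
rewrite big_split/= -[X in (X - _)^-1]mul1r -mulrBl.
have -> : \sum_j (\int[P]_w (gauss (c 0 j) t (X j w) ^+ 2) -
      (\int[P]_w gauss (c 0 j) t (X j w)) ^+ 2) *
      \prod_(k | k != j) \int[P]_w (gauss (c 0 k) t (X k w) ^+ 2) =
    (\sum_j (1 - r j t)) * \prod_j s j.
  rewrite mulr_suml; apply: eq_bigr => j _.
  rewrite sE mE [in RHS](bigD1 j)//= [in RHS]mulrA [in RHS]mulrBl mul1r; congr (_ * _).
  by apply: eq_bigr => k _; rewrite sE.
have s0 : \prod_j s j != 0 by apply/prodf_neq0 => j _; rewrite gt_eqF ?L0.
(* With [s0], this makes the variance nonzero, so its inverse is not the default value 0. *)
have p0 : 1 - \prod_j r j t != 0 by rewrite gt_eqF// subr_gt0.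
by rewrite tE; congr EFin; field; rewrite s0 p0.
Qed.
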